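(* Let $p$ be a prime, $\mathbb{F}_q$ a finite field of characteristic $p$, and $0\le i_1,i_2<p$ integers. Let $C_1=\langle(x-1)^{i_1}\rangle\subset\mathbb{F}_q[x]/\langle x^p-1\rangle$ and $C_2=\langle(y-1)^{i_2}\rangle\subset\mathbb{F}_q[y]/\langle y^p-1\rangle$, of dimensions $k_1=p-i_1$ and $k_2=p-i_2$ over $\mathbb{F}_q$. Let $r$ be an integer with $1\le r\le k_1k_2$ and let $\alpha\ge0$ be the integer such that $\alpha k_1<r\le(\alpha+1)k_1$. Let $$S=\{(\beta,\beta,\dots,\beta,u_\beta,0,\dots,0)\in P(k_1,k_2,r):\ \alpha+1\le\beta\le\min\{k_2,r\}\},$$ where $0<u_\beta\le\beta$. Then $$d_r(C_1\otimes C_2)=d_r^{*}(C_1\otimes C_2)=\min\{\bigtriangledown(\pi):\ \pi\in S\}.$$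
   Context: Elements of $\mathbb{F}_q[x]/\langle x^p-1\rangle$ are identified with their coefficient vectors in $\mathbb{F}_q^p$, so ideals are linear codes of length $p$. Product code: for linear codes $C,C'$ over $\mathbb{F}_q$, $C\otimes C'$ is the linear code of all two-dimensional arrays each of whose rows is a codeword of $C$ and each of whose columns is a codeword of $C'$. Generalized Hamming weights: the support of $c=(c_1,\dots,c_m)\in\mathbb{F}_q^m$ is $\chi(c)=\{i:c_i\neq0\}$, and for $D\subset\mathbb{F}_q^m$, $\chi(D)=\bigcup_{c\in D}\chi(c)$. For a linear code $C$, $d_r(C)=\min\{\#\chi(D): D\le C\text{ a subspace},\ \dim D=r\}$; thus $d_0(C)=0$. Partitions: a $(k_1,k_2)$-partition of $r$ is a non-increasing sequence $\pi=(t_1,\dots,t_{k_1})$ of nonnegative integers with $t_1+\cdots+t_{k_1}=r$ and $t_i\le k_2$ for all $i$; $P(k_1,k_2,r)$ is the set of all of them. For $\pi=(t_1,\dots,t_{k_1})\in P(k_1,k_2,r)$, $$\bigtriangledown(\pi)=\sum_{i=1}^{k_1}\bigl(d_i(C_1)-d_{i-1}(C_1)\bigr)d_{t_i}(C_2),$$ and $d_r^{*}(C_1\otimes C_2)=\min\{\bigtriangledown(\pi):\pi\in P(k_1,k_2,r)\}$. *)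

(* Defs.v *)
From HB Require Import structures.
From mathcomp Require Import all_boot all_order all_algebra.

Set Implicit Arguments.
Unset Strict Implicit.
Unset Printing Implicit Defensive.

Import GRing.Theory.
(* For the subType structure of {vspace vT}. *)
Import VectorInternalTheory.
Local Open Scope ring_scope.

(* Minimum of f over {x | P x}; the value is 0 when no x satisfies P. *)
Definition min_over (T : finType) (P : pred T) (f : T -> nat) : nat :=
  if [pick x | P x] is Some x0 then f [arg min_(x < x0 | P x) f x] else 0%N.

Lemma min_overP (T : finType) (P : pred T) (f : T -> nat) :
  (exists x, P x) ->
  exists x, [/\ P x, min_over P f = f x & forall y, P y -> (f x <= f y)%N].
Proof.
move=> [x Px]; rewrite /min_over.
case: pickP => [x0 Px0|/(_ x)]; last by rewrite Px.
by case: arg_minnP => // y Py ymin; exists y.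
Qed.

(* Over a finite field there are finitely many subspaces, so that minima over
   subspaces can be taken with [min_over]. *)
HB.instance Definition _ (F : finFieldType) (vT : vectType F) :=
  [Countable of {vspace vT} by <:].
HB.instance Definition _ (F : finFieldType) (vT : vectType F) :=
  [Finite of {vspace vT} by <:].

Section Codes.

Variable F : finFieldType.

(* Codes are subspaces of 'M[F]_(m, n): ordinary codes of length n are the case
   m = 1, i.e. subspaces of 'rV[F]_n, and product codes consist of arrays. *)

Definition supp m n (c : 'M[F]_(m, n)) : {set 'I_m * 'I_n} :=
  [set ij | c ij.1 ij.2 != 0].

Definition suppv m n (D : {vspace 'M[F]_(m, n)}) : {set 'I_m * 'I_n} :=
  \bigcup_(c in D) supp c.

Definition ghw m n (C : {vspace 'M[F]_(m, n)}) (r : nat) : nat :=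
  min_over [pred D : {vspace 'M[F]_(m, n)} | (D <= C)%VS && (\dim D == r)]
           (fun D => #|suppv D|).

Definition product_code m n (C : {vspace 'rV[F]_n}) (C' : {vspace 'rV[F]_m}) :
    {vspace 'M[F]_(m, n)} :=
  (\bigcap_(i < m) (linfun (@row F m n i) @^-1: C) :&:
   \bigcap_(j < n) (linfun (trmx \o @col F m n j) @^-1: C'))%VS.

Lemma mem_product_code m n (C : {vspace 'rV[F]_n}) (C' : {vspace 'rV[F]_m})
    (A : 'M[F]_(m, n)) :
  reflect ((forall i, row i A \in C) /\ (forall j, (col j A)^T \in C'))
          (A \in product_code C C').
Proof.
have bigcapE k (U : 'I_k -> {vspace 'M[F]_(m, n)}) :
    (A \in (\bigcap_i U i)%VS) = [forall i, A \in U i].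
  apply/idP/forallP => [/[swap] i|AU]; last by apply/subv_bigcapP => i _; exact: AU.
  by move: A; apply/subvP; exact: bigcapv_inf (subvv _).
rewrite memv_cap !bigcapE; apply: (iffP andP).
  by case=> /forallP Ar /forallP Ac; split=> [i|j]; 
    [have := Ar i | have := Ac j]; rewrite -memv_preim lfunE.
by case=> Ar Ac; split; apply/forallP => i; rewrite -memv_preim lfunE /=.
Qed.

(* F[x]/<x^p - 1>; 'qX below is the class of x. *)
Definition cyc_ring (p : nat) := {poly %/ ('X^p - 1 : {poly F})}.

Definition coef_row p (a : cyc_ring p) : 'rV[F]_p := \row_(j < p) (a : {poly F})`_j.

Definition principal_ideal p (g : cyc_ring p) : {set cyc_ring p} :=
  [set a * g | a : cyc_ring p].

(* The span only packages the coefficient vectors of the ideal, which already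
   form a subspace, as a {vspace _}; see [mem_ideal_code]. *)
Definition ideal_code p (g : cyc_ring p) : {vspace 'rV[F]_p} :=
  <<[seq coef_row a | a in principal_ideal g]>>%VS.

Lemma mem_ideal_code p (g : cyc_ring p) (c : 'rV[F]_p) :
  reflect (exists a, c = coef_row (a * g)) (c \in ideal_code g).
Proof.
apply: (iffP idP) => [|[a ->]]; last first.
  apply: memv_span; apply/imageP; exists (a * g) => //.
  by apply/imsetP; exists a.
move/coord_span=> ->; elim/big_ind: _ => [|_ _ [a ->] [b ->]|i _].
- by exists 0; apply/rowP => j; rewrite !mxE mul0r coef0.
- by exists (a + b); apply/rowP => j; rewrite !mxE mulrDl coefD.
- set k := coord _ _ _; rewrite -tnth_nth.
  set t := (t in tnth t _).
  have : tnth t i \in [seq coef_row a | a in principal_ideal g] by exact: mem_tnth.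
  case/imageP=> b /imsetP[a _ ->] ->; exists (k *: a).
  by apply/rowP => j; rewrite !mxE -scalerAl coefZ.
Qed.

Definition repeated_root_code p i : {vspace 'rV[F]_p} :=
  ideal_code (('qX - 1 : cyc_ring p) ^+ i).

End Codes.

Definition partitions (k1 k2 r : nat) : {set k1.-tuple 'I_k2.+1} :=
  [set t : k1.-tuple 'I_k2.+1 |
    sorted geq [seq val x | x <- t] && (\sum_(x <- t) val x == r)%N].

(* The sequences (beta, ..., beta, u, 0, ..., 0), with m >= 0 initial entries
   beta. *)
Definition two_value_partitions (alpha k1 k2 r : nat) :
    {set k1.-tuple 'I_k2.+1} :=
  [set t in partitions k1 k2 r |
    [exists beta : 'I_k2.+1, exists u : 'I_k2.+1, exists m : 'I_k1,
      [&& (alpha + 1 <= beta <= minn k2 r)%N, (0 < u <= beta)%N &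
        [seq val x | x <- t] ==
          nseq m (val beta) ++ val u :: nseq (k1 - m.+1) 0%N]]].

Section Weights.

Variables (F : finFieldType) (n1 n2 : nat).
Variables (C1 : {vspace 'rV[F]_n1}) (C2 : {vspace 'rV[F]_n2}).

(* t_i is [tnth t i] with i starting from 0. The weights of C1 increase with
   their index up to \dim C1 ([ghw_leS]), so nothing is truncated when
   k1 = \dim C1. *)
Definition nabla k1 k2 (t : k1.-tuple 'I_k2.+1) : nat :=
  (\sum_(i < k1) (ghw C1 i.+1 - ghw C1 i) * ghw C2 (tnth t i))%N.

Definition dstar (r : nat) : nat :=
  min_over (mem (partitions (\dim C1) (\dim C2) r))
           (@nabla (\dim C1) (\dim C2)).

End Weights.

Lemma ghw_leS (F : finFieldType) m n (C : {vspace 'M[F]_(m, n)}) i :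
  (i < \dim C)%N -> (ghw C i <= ghw C i.+1)%N.
Proof.
have sub_dim k (U : {vspace 'M[F]_(m, n)}) : (k <= \dim U)%N ->
    exists2 D, (D <= U)%VS & \dim D = k.
  move=> kU; exists <<take k (vbasis U)>>%VS.
    by apply/span_subvP => v /mem_take; exact: vbasis_mem.
  have : free (take k (vbasis U)).
    by have := basis_free (vbasisP U); rewrite -{1}(cat_take_drop k (vbasis U)) => /catl_free.
  by rewrite /free => /eqP ->; rewrite size_takel ?size_tuple.
have neP k : (k <= \dim C)%N -> exists D : {vspace 'M[F]_(m, n)},
    [pred D : {vspace 'M[F]_(m, n)} | (D <= C)%VS && (\dim D == k)] D.
  by case/sub_dim=> D DC <-; exists D; rewrite /= DC eqxx.
move=> iC; have /(min_overP (fun D => #|suppv D|))[D] := neP _ iC.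
case=> /andP[DC /eqP dD]; rewrite -!/(ghw _ _) => -> _.
have /(min_overP (fun D => #|suppv D|))[E] := neP _ (ltnW iC).
case=> _; rewrite -!/(ghw _ _) => -> Emin.
have /sub_dim[D' D'D dD'] : (i <= \dim D)%N by rewrite dD.
apply: leq_trans (Emin D' _) _; first by rewrite /= (subv_trans D'D DC) dD' eqxx.
apply/subset_leq_card/bigcupsP => c /(subvP D'D) cD.
exact: bigcup_sup.
Qed.

(* Main.v *)
(* For an MDS code C of codimension d the k-th generalized Hamming weight is
   d + k for k > 0, so that for MDS codes C1, C2 of codimensions d_1, d_2,
   nabla(t) = d_1 (d_2 + t_1) + sum over t_i > 0 of (d_2 + t_i).  The
   ideals generated by (x - 1)^i in characteristic p are MDS.

   Lower bound.  Let D be an r-dimensional subcode of the product and s_x the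
   size of its support in column x.  Choose a set K of k1 columns with the
   smallest s_x.  As K is an information set of C1, and the words of C2 supported
   in s_x given places form a space of dimension at most s_x - d_2, we get
   r <= sum over x in K of max(0, s_x - d_2).  With d_2 + T the maximum of s_x on
   K and l the number of x in K with s_x > d_2, this gives r <= l T, while the
   d_1 columns outside K have s_x >= d_2 + T, so that D has support at least
   d_1 (d_2 + T) + l d_2 + r.  This dominates nabla of the two-value partition
   with beta = min(T, r).

   Upper bound.  The multiples x^a (x - 1)^i form a staircase basis, and the
   arrays spanned by the products of basis vectors indexed by the Young diagram
   of t have support at most nabla(t). *)
From HB Require Import structures.
Require Import Defs.
From mathcomp Require Import all_boot all_order all_algebra.
From mathcomp Require Import zify.

Set Implicit Arguments.
Unset Strict Implicit.
Unset Printing Implicit Defensive.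

(** * Minima and two-value partitions *)

Lemma min_over_leq (T : finType) (P : pred T) (f : T -> nat) x :
  P x -> min_over P f <= f x.
Proof.
move=> Px; have [|y [_ -> ->//]] := @min_overP _ P f; by exists x.
Qed.

Lemma card_ltn_ord n k : #|[set i : 'I_n | i < k]| = minn k n.
Proof.
rewrite -sum1dep_card; have [kn|nk] := leqP k n.
  by rewrite -(big_ord_widen n (fun=> 1) kn) sum1_card card_ord.
under eq_bigl => i do rewrite (ltn_trans (ltn_ord i) nk).
by rewrite sum1_card card_ord.
Qed.

(** Dividing [r.-1] rather than [r] keeps the last nonzero entry [r - m * beta] between 1 and [beta]
    even when [beta] divides [r]. The bound [r <= beta * k1] gives [m < k1], so the list fits into
    [k1] entries. *)
Lemma exists_two_value_partition alpha k1 k2 r beta :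
    0 < k1 -> r <= beta * k1 -> alpha < beta <= minn k2 r ->
  exists2 t, t \in two_value_partitions alpha k1 k2 r &
    let m := r.-1 %/ beta in
    [seq val x | x <- t] = nseq m beta ++ r - m * beta :: nseq (k1 - m.+1) 0.
Proof.
move=> k1_gt0 rk1 /andP[ab]; rewrite leq_min => /andP[bk2 br].
have b0 : 0 < beta by apply: leq_trans ab.
set m := r.-1 %/ beta.
have mb : m * beta < r by have := leq_trunc_div r.-1 beta; rewrite -/m; lia.
have rm : r <= m * beta + beta.
  by have := ltn_ceil r.-1 b0; rewrite -/m mulSn; lia.
have mk1 : m < k1.
  rewrite -(ltn_pmul2r b0); apply: leq_trans mb _; by rewrite mulnC.
pose s := nseq m beta ++ r - m * beta :: nseq (k1 - m.+1) 0.
have size_s : size s = k1.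
  by rewrite size_cat /= !size_nseq addnS; lia.
have s_le : all (fun x => x <= k2) s.
  by rewrite all_cat /= !all_nseq bk2 !orbT andbT /=; lia.
pose t : k1.-tuple 'I_k2.+1 := map_tuple inord (tcast size_s (in_tuple s)).
have val_t : [seq val x | x <- t] = s.
  rewrite /= -map_comp val_tcast /= map_id_in // => x /(allP s_le) xk2.
  by rewrite /= inordK.
exists t => //=; rewrite inE; apply/andP; split.
  rewrite inE val_t; apply/andP; split.
    rewrite sorted_pairwise => [|x y z]; last by rewrite /= => yx /leq_trans; apply.
    rewrite pairwise_cat /= allrel_consr.
    have pn c x : pairwise geq (nseq c x).
      elim: c => //= c ->; rewrite andbT; apply/allP => y /nseqP[-> _]; exact: leqnn.
    rewrite !pn andTb andbT -andbA; apply/and3P; split.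
    - by rewrite all_nseq /=; apply/orP; right; lia.
    - by apply/allrelP => x y _ /nseqP[-> _]; exact: leq0n.
    - by rewrite all_nseq /= orbT.
  rewrite -(big_map val predT id) val_t /s big_cat big_cons /= !big_nseq.
  by rewrite !iter_addn; lia.
apply/existsP; exists (inord beta); apply/existsP; exists (inord (r - m * beta)).
apply/existsP; exists (Ordinal mk1); rewrite val_t.
rewrite /= !inordK ?ltnS //; last by lia.
apply/and3P; split=> //; last by lia.
by rewrite leq_min bk2 br addn1 ab.
Qed.

(** * Dimension counts by restricting arrays to a set of places *)

Section LinearCodes.

Import GRing.Theory.
Local Open Scope ring_scope.

Variable F : finFieldType.

Definition restr_supp m n (Y : {set 'I_m * 'I_n}) (A : 'M[F]_(m, n)) : 'rV[F]_#|Y| :=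
  \row_k A (enum_val k).1 (enum_val k).2.

Fact restr_supp_is_linear m n (Y : {set 'I_m * 'I_n}) : linear (restr_supp Y).
Proof. by move=> a A B; apply/rowP => k; rewrite !mxE. Qed.

HB.instance Definition _ m n (Y : {set 'I_m * 'I_n}) :=
  GRing.isLinear.Build F 'M[F]_(m, n) 'rV[F]_#|Y| _ (restr_supp Y)
    (restr_supp_is_linear Y).

Lemma restr_supp_eq0 m n (Y : {set 'I_m * 'I_n}) (A : 'M[F]_(m, n)) :
  (restr_supp Y A == 0) = [disjoint Y & supp A].
Proof.
apply/eqP/pred0P => [A0 ij | YA]; last first.
  apply/rowP => k; rewrite !mxE; apply/eqP/negbFE.
  by have /= := YA (enum_val k); rewrite enum_valP inE.
rewrite /= inE; case Yij: (ij \in Y) => //=.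
have /rowP/(_ (enum_rank_in Yij ij)) := A0.
by rewrite !mxE enum_rankK_in // => ->; rewrite eqxx.
Qed.

Lemma memv_ker_restr_supp m n (Y : {set 'I_m * 'I_n}) (A : 'M[F]_(m, n)) :
  (A \in lker (linfun (restr_supp Y))) = [disjoint Y & supp A].
Proof. by rewrite memv_ker lfunE restr_supp_eq0. Qed.

Lemma dimv_leq_rV n (U : {vspace 'rV[F]_n}) : (\dim U <= n)%N.
Proof. by rewrite (leq_trans (dimvS (subvf _))) // dimvf dim_matrix mul1r. Qed.

(** Restriction to [Y] is injective on [D], so [D] embeds into a space of dimension [#|Y|]. *)
Lemma dimv_leq_restr_supp m n (D : {vspace 'M[F]_(m, n)}) (Y : {set 'I_m * 'I_n}) :
  (forall A, A \in D -> [disjoint Y & supp A] -> A = 0) -> (\dim D <= #|Y|)%N.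
Proof.
move=> D0; have Dker : (D :&: lker (linfun (restr_supp Y)) = 0)%VS.
  apply/eqP; rewrite -subv0; apply/subvP => A.
  by rewrite memv_cap memv_ker_restr_supp => /andP[/D0 H /H ->]; rewrite mem0v.
by rewrite -(limg_dim_eq Dker) dimv_leq_rV.
Qed.

(** Each place of [Y] where the words must vanish costs at most one dimension. *)
Lemma dimv_leq_ker_restr_supp m n (D : {vspace 'M[F]_(m, n)}) (Y : {set 'I_m * 'I_n}) :
  (\dim D - #|Y| <= \dim (D :&: lker (linfun (restr_supp Y))))%N.
Proof.
rewrite leq_subLR -(limg_ker_dim (linfun (restr_supp Y)) D) addnC leq_add2r.
exact: dimv_leq_rV.
Qed.

Lemma sub_suppv m n (D : {vspace 'M[F]_(m, n)}) (X : {set 'I_m * 'I_n}) :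
  reflect (forall A, A \in D -> supp A \subset X) (suppv D \subset X).
Proof. exact: bigcupsP. Qed.

Lemma ghw_leq m n (C D : {vspace 'M[F]_(m, n)}) (X : {set 'I_m * 'I_n}) :
  (D <= C)%VS -> suppv D \subset X -> (ghw C (\dim D) <= #|X|)%N.
Proof.
move=> DC DX; apply: leq_trans (subset_leq_card DX).
by apply: (min_over_leq (fun E => #|suppv E|)); rewrite /= DC eqxx.
Qed.

Lemma subv_dim_eq (vT : vectType F) (U : {vspace vT}) k :
  (k <= \dim U)%N -> exists2 D, (D <= U)%VS & \dim D = k.
Proof.
move=> kU; exists <<take k (vbasis U)>>%VS.
  by apply/span_subvP => v /mem_take; exact: vbasis_mem.
have : free (take k (vbasis U)).
  by have := basis_free (vbasisP U);
     rewrite -{1}(cat_take_drop k (vbasis U)) => /catl_free.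
by rewrite /free => /eqP ->; rewrite size_takel ?size_tuple.
Qed.

Lemma ghwP m n (C : {vspace 'M[F]_(m, n)}) k : (k <= \dim C)%N ->
  exists D : {vspace 'M[F]_(m, n)},
    [/\ (D <= C)%VS, \dim D = k & ghw C k = #|suppv D|].
Proof.
case/subv_dim_eq => D DC Dk; rewrite /ghw.
have [|E [/andP[EC /eqP Ek] -> _]] := @min_overP _ [pred E : {vspace 'M[F]_(m, n)} |
  (E <= C)%VS && (\dim E == k)] (fun E => #|suppv E|).
  by exists D; rewrite /= DC Dk eqxx.
by exists E.
Qed.

Lemma ghw0 m n (C : {vspace 'M[F]_(m, n)}) : ghw C 0 = 0%N.
Proof.
have := @ghw_leq _ _ C 0%VS set0 (sub0v C); rewrite dimv0 cards0 leqn0.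
move=> H; apply/eqP/H/sub_suppv => A; rewrite memv0 => /eqP->.
by apply/subsetP => ij; rewrite !inE mxE eqxx.
Qed.

(** * MDS codes and their generalized Hamming weights *)

Definition weight_gt n (C : {vspace 'rV[F]_n}) d :=
  forall c, c \in C -> (#|supp c| <= d)%N -> c = 0.

Lemma exists_subset_card (T : finType) (X : {set T}) k :
  (k <= #|X|)%N -> exists2 Y : {set T}, Y \subset X & #|Y| = k.
Proof.
move=> kX; exists [set x in take k (enum X)].
  by apply/subsetP => x; rewrite inE => /mem_take; rewrite mem_enum.
rewrite cardsE; have /card_uniqP -> : uniq (take k (enum X)).
  by rewrite take_uniq // enum_uniq.
by rewrite size_takel // -cardE.
Qed.

(** Generalized Singleton bound: let [Y] be the support without [d] of its places. A word of [D]
    vanishing on [Y] has weight at most [d], so it is zero. *)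
Lemma dimv_leq_suppv n (C D : {vspace 'rV[F]_n}) d :
  weight_gt C d -> (D <= C)%VS -> (\dim D <= #|suppv D| - d)%N.
Proof.
move=> Cd /subvP DC; have [Y YX cY] := exists_subset_card (leq_subr d #|suppv D|).
rewrite -cY; apply: dimv_leq_restr_supp => c cD Yc; apply: Cd (DC _ cD) _.
have: supp c \subset suppv D :\: Y.
  rewrite subsetD disjoint_sym Yc andbT.
  exact: (@bigcup_sup _ _ c).
by move=> /subset_leq_card; rewrite cardsD (setIidPr YX) cY; lia.
Qed.

Lemma dimv_leq_weight_gt n (C : {vspace 'rV[F]_n}) d :
  weight_gt C d -> (\dim C <= n - d)%N.
Proof.
move=> Cd; apply: leq_trans (dimv_leq_suppv Cd (subvv C)) _.
by rewrite leq_sub2r // (leq_trans (max_card _)) // card_prod !card_ord mul1n.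
Qed.

Definition mds n (C : {vspace 'rV[F]_n}) d :=
  weight_gt C d /\ \dim C = (n - d)%N.

Definition mds_ghw d k := (if k is 0 then 0 else d + k)%N.

(** The lower bound is [dimv_leq_suppv]. For the upper bound any [d + k] places will do: vanishing
    on the other [n - (d + k)] places leaves dimension at least [k] out of [n - d]. *)
Lemma ghw_mds n (C : {vspace 'rV[F]_n}) d k :
  mds C d -> (k <= n - d)%N -> ghw C k = mds_ghw d k.
Proof.
case: k => [|k] [Cd dC]; first by rewrite ghw0.
rewrite /mds_ghw; move: k.+1 (ltn0Sn k) => {}k k0 kC.
apply/eqP; rewrite eqn_leq; apply/andP; split; last first.
  have [|D [DC dD ->]] := @ghwP _ _ C k; first by rewrite dC.
  by have := dimv_leq_suppv Cd DC; rewrite dD; lia.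
have dk : (d + k <= n)%N by lia.
have [|X _ cX] := @exists_subset_card _ [set: 'I_1 * 'I_n] (d + k).
  by rewrite cardsT card_prod !card_ord mul1n.
have cXc : #|~: X| = (n - (d + k))%N.
  by rewrite cardsCs setCK cX card_prod !card_ord mul1n.
have [|D DC dD] := @subv_dim_eq _ (C :&: lker (linfun (restr_supp (~: X))))%VS k.
  by apply: leq_trans (dimv_leq_ker_restr_supp _ _); lia.
rewrite -cX -{1}dD; apply: ghw_leq; first exact: subv_trans DC (capvSl _ _).
apply/sub_suppv => c /(subvP DC); rewrite memv_cap memv_ker_restr_supp => /andP[_].
by rewrite disjoints_subset setCS.
Qed.

(** * Subcodes of product codes, column by column *)

Definition col_set m n (X : {set 'I_m * 'I_n}) (x : 'I_n) : {set 'I_m} :=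
  [set y | (y, x) \in X].

Lemma card_col_set m n (X : {set 'I_m * 'I_n}) :
  #|X| = (\sum_x #|col_set X x|)%N.
Proof.
rewrite -sum1_card (partition_big (fun yx => yx.2) predT) //=.
apply: eq_bigr => x _; rewrite -sum1_card.
rewrite (reindex_onto (fun y => (y, x)) (fun yx => yx.1)) /=.
  by apply: eq_bigl => y; rewrite !inE /= !eqxx !andbT.
by move=> [y x'] /= /andP[_ /eqP->].
Qed.

(** In each column [x] of [K], [Y x] keeps all but [d'] places of the support. An array of [D]
    vanishing on the kept places has zero columns over [K], by the distance of [C']. Its rows then
    live on the at most [d] columns outside [K], so they vanish by the distance of [C]. *)
Lemma dimv_leq_product m n (C : {vspace 'rV[F]_n}) (C' : {vspace 'rV[F]_m})
    d d' (D : {vspace 'M[F]_(m, n)}) (K : {set 'I_n}) :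
    weight_gt C d -> weight_gt C' d' -> (D <= product_code C C')%VS ->
    (n - d <= #|K|)%N ->
  (\dim D <= \sum_(x in K) (#|col_set (suppv D) x| - d'))%N.
Proof.
move=> Cd C'd' /subvP DC Kd.
have Yex x : exists2 Y : {set _}, Y \subset col_set (suppv D) x &
    #|Y| = (#|col_set (suppv D) x| - d')%N.
  by apply: exists_subset_card; rewrite leq_subr.
have [Y YX cY] := fin_all_exists2 Yex.
pose Z := [set yx : 'I_m * 'I_n | (yx.2 \in K) && (yx.1 \in Y yx.2)].
have -> : (\sum_(x in K) (#|col_set (suppv D) x| - d') = #|Z|)%N.
  rewrite card_col_set big_mkcond; apply: eq_bigr => x _.
  case: ifP => xK; last by apply/esym/eqP; rewrite cards_eq0 -subset0;
    apply/subsetP => y; rewrite !inE xK.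
  by rewrite -cY; congr #|pred_of_set _|; apply/setP => y; rewrite !inE xK.
apply: dimv_leq_restr_supp => A AD ZA.
have [Arow Acol] := mem_product_code _ _ _ (DC _ AD).
have colK x : x \in K -> col x A = 0.
  move=> xK; apply: trmx_inj; rewrite trmx0; apply: C'd' (Acol x) _.
  have : [set j.2 | j in supp (col x A)^T] \subset col_set (suppv D) x :\: Y x.
    apply/subsetP => _ /imsetP[[i y] /[swap] -> /=]; rewrite !inE !mxE /= => Ayx.
    have Ayx' : (y, x) \in supp A by rewrite inE.
    rewrite (subsetP (bigcup_sup A AD)) // andbT.
    apply: contraTN Ayx' => yY.
    by rewrite (disjointFr ZA) // inE /= xK.
  move/subset_leq_card; rewrite card_imset; last first.
    by move=> [i y] [i' y'] /= ->; rewrite !ord1.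
  rewrite cardsD (setIidPr (YX x)) cY => /leq_trans; apply.
  by rewrite leq_subLR addnC -leq_subLR.
apply/row_matrixP => y; rewrite row0; apply: Cd (Arow y) _.
have : [set j.2 | j in supp (row y A)] \subset ~: K.
  apply/subsetP => _ /imsetP[[i x] /[swap] -> /=]; rewrite !inE !mxE /=.
  apply: contraNN => /colK /matrixP/(_ y 0); rewrite !mxE => ->; exact: eqxx.
move/subset_leq_card; rewrite card_imset; last first.
  by move=> [i x] [i' x'] /= ->; rewrite !ord1.
move/leq_trans; apply; rewrite cardsCs setCK card_ord.
by rewrite leq_subLR addnC -leq_subLR.
Qed.

(** The weights of [C1] increase by [d1 + 1] at the first index and by 1 afterwards, whence [d1]
    extra copies of the first term. *)
Lemma nabla_mds n1 n2 (C1 : {vspace 'rV[F]_n1}) (C2 : {vspace 'rV[F]_n2}) d1 d2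
    (t : (n1 - d1).-tuple 'I_(n2 - d2).+1) :
    mds C1 d1 -> mds C2 d2 ->
  nabla C1 C2 t = (d1 * mds_ghw d2 (head 0 [seq val x | x <- t]) +
                   \sum_(x <- t) mds_ghw d2 x)%N.
Proof.
move=> C1d C2d; rewrite /nabla big_tuple.
under eq_bigr => i _.
  rewrite (ghw_mds C2d) ?(leq_ord (tnth t i)) //.
  rewrite (ghw_mds C1d (ltn_ord i)) (ghw_mds C1d (ltnW (ltn_ord i))).
  over.
case: (n1 - d1)%N t => [|k] t.
  by rewrite !big_ord0 tuple0 /= muln0.
rewrite !big_ord_recl /= subn0 {1}addn1 mulSn.
case/tupleP: t => x t; rewrite tnth0 /=.
under eq_bigr do rewrite addnS subSnn mul1n.
by rewrite addnCA addnA.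
Qed.

(** Greedy choice: add an element minimizing [s] outside the set built so far. *)
Lemma exists_min_subset (T : finType) (s : T -> nat) k :
  (k <= #|T|)%N ->
  exists2 K : {set T}, #|K| = k & forall x y, x \in K -> y \notin K -> (s x <= s y)%N.
Proof.
elim: k => [|k IHk] kT; first by exists set0; rewrite ?cards0 // => x y; rewrite inE.
have [K cK Kmin] := IHk (ltnW kT).
have /card_gt0P[y0 y0K] : (0 < #|~: K|)%N by rewrite cardsCs setCK cK subn_gt0.
case: (@arg_minnP _ y0 (mem (~: K)) s y0K) => z; rewrite !inE => zK zmin.
exists (z |: K); first by rewrite cardsU1 cK zK.
move=> x y /setU1P[->|xK]; rewrite !inE negb_or => /andP[_ yK].
  by apply: zmin; rewrite !inE.
exact: Kmin.
Qed.

(** The columns outside [K] give [d * (d' + T)]. Each of the [l] columns of [K] taller than [d']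
    gives [d'] plus its excess, and the excesses add up to at least [\dim D]. *)
Lemma leq_suppv_product m n (C : {vspace 'rV[F]_n}) (C' : {vspace 'rV[F]_m})
    d d' (D : {vspace 'M[F]_(m, n)}) :
    weight_gt C d -> weight_gt C' d' -> (D <= product_code C C')%VS ->
    (d <= n)%N -> (0 < \dim D)%N ->
  exists T l, [/\ T <= m - d', l <= n - d, \dim D <= l * T &
    d * (d' + T) + l * d' + \dim D <= #|suppv D|]%N.
Proof.
move=> Cd C'd' DC dn D0; pose s x := #|col_set (suppv D) x|.
have [|K cK Kmin] := @exists_min_subset _ s (n - d); first by rewrite card_ord leq_subr.
have := dimv_leq_product Cd C'd' DC (eq_leq (esym cK)).
rewrite -/(s _); set S := (\sum_(x in K) _)%N => DS.
pose M := (\max_(x in K) s x)%N; pose L := [set x in K | (d' < s x)%N].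
have S_L : S = (\sum_(x in L) (s x - d'))%N.
  rewrite /S (bigID (fun x => d' < s x)%N) /= addnC big1 ?add0n; last first.
    by move=> x /andP[_]; rewrite -leqNgt -subn_eq0 => /eqP.
  by apply: eq_bigl => x; rewrite inE.
have sM x : x \in K -> (s x <= M)%N by move=> xK; exact: leq_bigmax_cond.
have SLM : (S <= #|L| * (M - d'))%N.
  rewrite S_L -sum_nat_const; apply: leq_sum => x; rewrite inE => /andP[xK _].
  by rewrite leq_sub2r ?sM.
(* Positivity makes [d' + (M - d') = M] valid for truncated subtraction. *)
have M0 : (0 < M - d')%N.
  by move: SLM; case: (M - d')%N => //; rewrite muln0; move: DS D0; lia.
have LK : (#|L| <= n - d)%N.
  by rewrite -cK subset_leq_card //; apply/subsetP => x; rewrite inE => /andP[].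
exists (M - d')%N, #|L|; split=> //.
- rewrite leq_sub2r //; apply/bigmax_leqP => x _.
  by rewrite (leq_trans (max_card _)) // card_ord.
- exact: leq_trans SLM.
rewrite card_col_set (bigID (mem K)) /= -addnA addnC leq_add //.
  rewrite (bigID (mem L)) /= (leq_trans _ (leq_addr _ _)) //.
  apply: (@leq_trans (\sum_(x in L) (d' + (s x - d')))%N).
    by rewrite big_split /= sum_nat_const -S_L leq_add2l.
  rewrite [leqRHS](eq_bigl (mem L)) => [|x]; last first.
    by rewrite /= !inE; case: (x \in K).
  by apply: leq_sum => x; rewrite inE => /andP[_ /ltnW dx]; rewrite subnKC.
have -> : (d' + (M - d') = M)%N by lia.
have -> : d = #|~: K| by rewrite cardsCs setCK cK card_ord subKn.
rewrite -sum_nat_const (eq_bigl (fun x => x \notin K)) => [|x]; last by rewrite inE.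
apply: leq_sum => y yK; apply/bigmax_leqP => x xK; exact: Kmin.
Qed.

Lemma leq_mds_ghw d k : (mds_ghw d k <= d + k)%N.
Proof. by case: k. Qed.

Lemma nabla_two_value_leq n1 n2 (C1 : {vspace 'rV[F]_n1}) (C2 : {vspace 'rV[F]_n2})
    d1 d2 alpha (D : {vspace 'M[F]_(n2, n1)}) :
    mds C1 d1 -> mds C2 d2 -> (d1 < n1)%N ->
    (D <= product_code C1 C2)%VS -> (alpha * (n1 - d1) < \dim D)%N ->
  exists2 t, t \in two_value_partitions alpha (n1 - d1) (n2 - d2) (\dim D) &
    (nabla C1 C2 t <= #|suppv D|)%N.
Proof.
move=> C1d C2d dn1 DC aD; set r := (\dim D) in aD *.
have r0 : (0 < r)%N by apply: leq_ltn_trans aD.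
have [T [l [Tk2 lk1 rlT suppD]]] :=
  leq_suppv_product C1d.1 C2d.1 DC (ltnW dn1) r0.
rewrite -/r in rlT suppD; have [l0 T0] : (0 < l)%N /\ (0 < T)%N by move: rlT r0; nia.
have k1_gt0 : (0 < n1 - d1)%N by lia.
(* Here [alpha * (n1 - d1) < r <= l * T <= (n1 - d1) * T]. *)
have aT : (alpha < T)%N by nia.
have ar : (alpha < r)%N by nia.
(* The family requires [beta <= r]; capping at [r] preserves [r <= l * beta] because [l] is
   positive. *)
pose beta := minn T r; have b0 : (0 < beta)%N by rewrite leq_min T0.
have rlb : (r <= l * beta)%N by rewrite /beta; case: (leqP T r) => // _; exact: leq_pmull.
have [|||t tS val_t] := @exists_two_value_partition alpha (n1 - d1) (n2 - d2) r beta.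
- exact: k1_gt0.
- by rewrite mulnC (leq_trans rlb) // leq_mul2r lk1 orbT.
- by rewrite /beta !leq_min !geq_minr geq_min Tk2 aT ar.
exists t => //; apply: leq_trans suppD; rewrite nabla_mds //.
set m := (r.-1 %/ beta)%N in val_t.
have mb : (m * beta < r)%N by have := leq_trunc_div r.-1 beta; rewrite -/m; lia.
have ml : (m < l)%N by rewrite -(ltn_pmul2r b0) (leq_trans mb).
(* The first part is at most [beta <= T], and the [m.+1 <= l] nonzero parts contribute at most
   [m.+1 * d2 + r]. *)
rewrite val_t -addnA leq_add //.
  rewrite leq_mul2l; apply/orP; right; apply: leq_trans (leq_mds_ghw _ _) _.
  rewrite leq_add2l; apply: (@leq_trans beta); last exact: geq_minl.
  have := ltn_ceil r.-1 b0; rewrite -/m mulSn.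
  by case: (m) => [|m'] /=; lia.
rewrite -(big_map val predT (mds_ghw d2)) val_t big_cat big_cons /= !big_nseq !iter_addn.
have := leq_mds_ghw d2 beta; have := leq_mds_ghw d2 (r - m * beta).
have : (m.+1 * d2 <= l * d2)%N by rewrite leq_mul2r ml orbT.
rewrite !mul0n !addn0 mulSn.
move=> H1 H2 H3; have := leq_mul H3 (leqnn m).
rewrite mulnDl (mulnC beta) (mulnC d2) => H4; lia.
Qed.

(* A product of staircase matrices is supported on a Young diagram shifted by
   (d2, d1): D is the span of the rank one arrays indexed by the cells of t. *)
Lemma exists_subcode_leq_nabla n1 n2 (C1 : {vspace 'rV[F]_n1}) (C2 : {vspace 'rV[F]_n2})
    d1 d2 r (t : (n1 - d1).-tuple 'I_(n2 - d2).+1)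
    (A1 : 'M[F]_(n1 - d1, n1)) (A2 : 'M[F]_(n2 - d2, n2)) :
    mds C1 d1 -> mds C2 d2 -> (d1 <= n1)%N ->
    row_free A1 -> row_free A2 ->
    (forall u, u *m A1 \in C1) -> (forall u, u *m A2 \in C2) ->
    (forall (a : 'I_(n1 - d1)) (x : 'I_n1), (d1 + a < x)%N -> A1 a x = 0) ->
    (forall (b : 'I_(n2 - d2)) (y : 'I_n2), (d2 + b < y)%N -> A2 b y = 0) ->
    t \in partitions (n1 - d1) (n2 - d2) r ->
  exists D : {vspace 'M[F]_(n2, n1)},
    [/\ (D <= product_code C1 C2)%VS, \dim D = r & (#|suppv D| <= nabla C1 C2 t)%N].
Proof.
move=> C1d C2d dn1 A1free A2free A1C A2C A1stair A2stair; rewrite inE.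
move=> /andP[t_sorted /eqP t_r].
pose Y := [set ba : 'I_(n2 - d2) * 'I_(n1 - d1) | (ba.1 < tnth t ba.2)%N].
have cY : #|Y| = r.
  rewrite card_col_set -t_r big_tuple; apply: eq_bigr => a _.
  have ta := leq_ord (tnth t a).
  rewrite -[RHS](minn_idPl ta) -card_ltn_ord.
  by apply: eq_card => b; rewrite !inE.
pose U := lker (linfun (@restr_supp (n2 - d2) (n1 - d1) (~: Y))).
have memU c (b : 'I__) a : c \in U -> ~~ (b < tnth t a)%N -> c b a = 0.
  rewrite memv_ker_restr_supp => Yc ba; apply: contraTeq isT => cba.
  by have := disjointFl Yc (_ : (b, a) \in supp c); rewrite !inE /= => /(_ cba); rewrite ba.
have dimU : \dim U = r.
  apply/eqP; rewrite eqn_leq -{1}cY; apply/andP; split.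
    apply: dimv_leq_restr_supp => c cU Yc; apply/matrixP => b a; rewrite mxE.
    have [ba|/(memU _ _ _ cU) //] := boolP (b < tnth t a)%N.
    by have := disjointFr Yc (_ : (b, a) \in Y); rewrite !inE /= => /(_ ba) /eqP.
  have := dimv_leq_ker_restr_supp fullv (~: Y); rewrite capfv; apply: leq_trans.
  rewrite dimvf dim_matrix cardsCs setCK cY card_prod !card_ord subKn //.
  rewrite -cY (leq_trans (max_card _)) // card_prod !card_ord //.
(* The entry of [c] at [(b, a)] is the coefficient of the outer product of row [b] of [A2] and row
   [a] of [A1]. *)
pose f := linfun (mulmx A2^T \o mulmxr A1) : 'Hom('M[F]_(n2 - d2, n1 - d1), 'M[F]_(n2, n1)).
have fE c : f c = A2^T *m (c *m A1) by rewrite lfunE.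
have f_inj : lker f == 0%VS.
  apply/lker0P => c c'; rewrite !fE !mulmxA => /(row_free_inj A1free).
  move/(congr1 trmx); rewrite !trmx_mul trmxK => /(row_free_inj A2free).
  exact: trmx_inj.
pose D := (f @: U)%VS.
have dimD : \dim D = r by rewrite limg_dim_eq // (eqP f_inj) capv0.
(* [g (x - d1)] bounds the height of column [x]; truncated subtraction assigns the first part of [t]
   to every [x <= d1]. *)
pose g x := mds_ghw d2 (nth 0 [seq val x | x <- t] x)%N.
pose X := [set yx : 'I_n2 * 'I_n1 | (yx.1 < g (yx.2 - d1))%N].
exists D; split=> //.
  apply/subvP => _ /memv_imgP[c cU ->]; rewrite fE; apply/mem_product_code.
  split=> [y|x]; first by rewrite mulmxA row_mul.
  by rewrite colE -mulmxA trmx_mul trmxK.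
apply: (@leq_trans #|X|).
  apply/subset_leq_card/sub_suppv => _ /memv_imgP[c cU ->]; rewrite fE.
  apply/subsetP => -[y x]; rewrite !inE /=; apply: contraNT; rewrite -leqNgt => gy.
  rewrite mulmxA mxE big1 // => a _; rewrite mxE mulr_suml big1 // => b _; rewrite mxE.
  have [/A1stair->|xa] := ltnP (d1 + a) x; first by rewrite mulr0.
  have [/A2stair->|yb] := ltnP (d2 + b) y; first by rewrite !mul0r.
  rewrite (memU c) ?mulr0 ?mul0r //; apply/negP => bt.
  (* A nonzero contribution of the cell [(b, a)] needs [x - d1 <= a], [y <= d2 + b] and
     [b < tnth t a]. As [t] is non-increasing, [y] is then less than [d2] plus the part of index
     [x - d1]. *)
  have tle : (tnth t a <= nth 0 [seq val x | x <- t] (x - d1))%N.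
    have -> : tnth t a = nth 0%N [seq val x | x <- t] a :> nat.
      by rewrite (nth_map ord0) ?size_tuple // -tnth_nth.
    apply: (sorted_leq_nth (leT := geq)).
    - by move=> u v w /= vu /leq_trans; apply.
    - exact: leqnn.
    - exact: t_sorted.
    - by rewrite inE size_map size_tuple; have := ltn_ord a; lia.
    - by rewrite inE size_map size_tuple.
    - by rewrite leq_subLR.
  move: gy; rewrite /g; move: tle.
  by case: (nth _ _ _) => [|k] /= ? ?; lia.
rewrite card_col_set nabla_mds //.
apply: (@leq_trans (\sum_(x < n1) g (x - d1))%N).
  apply: leq_sum => x _; apply: leq_trans (geq_minl _ n2); rewrite -card_ltn_ord.
  by apply/subset_leq_card/subsetP => y; rewrite !inE.
(* The first [d1] columns give [d1] copies of [g 0], the others one term for each part of [t]. *)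
rewrite -(big_mkord predT (fun x => g (x - d1)%N)) (big_cat_nat (n := d1)) //=.
rewrite leq_add //.
  rewrite big_nat (eq_bigr (fun _ => g 0%N)) => [|x /= xd]; last first.
    by congr g; lia.
  by rewrite -big_nat sum_nat_const_nat subn0 /g nth0.
rewrite -{1}[d1]add0n big_addn big_mkord big_tuple.
apply: leq_sum => i _; rewrite addnK /g (nth_map ord0) ?size_tuple //.
by rewrite -tnth_nth.
Qed.

End LinearCodes.

(** * Repeated-root cyclic codes are MDS *)

Section RepeatedRoot.

Import GRing.Theory.
Local Open Scope ring_scope.

Variables (F : finFieldType) (p : nat).

Lemma natf_inj_pchar i j : p \in [pchar F] ->
  (i < p)%N -> (j < p)%N -> i%:R = j%:R :> F -> i = j.
Proof.
move=> pF; wlog ij : i j / (i <= j)%N => [H ip jp e|].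
  by have [/H|/ltnW/H e'] := leqP i j; [apply | apply/esym/e'].
move=> _ jp e; apply/eqP; rewrite eqn_leq ij -subn_eq0 /=.
have : (p %| j - i)%N by rewrite (dvdn_pcharf pF) natrB // e subrr.
have [-> //|ji] := posnP (j - i)%N.
by move/(dvdn_leq ji); rewrite leqNgt (leq_ltn_trans (leq_subr _ _)).
Qed.

(* If m is in the support of f, then ['X * f^`() - m%:R *: f] has the support of
   f with m removed, and vanishes at 1 to order at least one less than f. *)
Lemma repeated_root_weight (f : {poly F}) i :
    p \in [pchar F] -> (size f <= p)%N -> ('X - 1) ^+ i %| f ->
  (#|[set j : 'I_p | (f`_j != 0)%R]| <= i)%N -> f = 0.
Proof.
move=> pF; elim: i f => [|i IHi] f fp rf cf; apply/eqP/negPn/negP => f0.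
all: have mp : ((size f).-1 < p)%N by rewrite prednK // size_poly_gt0.
all: pose m := Ordinal mp.
all: have fm : f`_m != 0 by rewrite -[f`_m]/(lead_coef f) lead_coef_eq0.
  by move: cf; rewrite leqn0 cards_eq0 => /eqP/setP/(_ m); rewrite !inE fm.
pose g := 'X * f^`() - m%:R *: f.
have gE j : g`_j = (j%:R - m%:R) * f`_j.
  rewrite coefB coefXM coefZ mulrBl; congr (_ - _).
  by case: j => [|j] /=; rewrite ?mul0r // coef_deriv mulr_natl.
have rf' : ('X - 1) ^+ i %| f^`().
  have [q ->] := dvdpP _ _ rf; rewrite derivM deriv_exp /= dvdp_add //.
    by rewrite dvdp_mull // dvdp_exp2l.
  by apply: dvdp_mull; rewrite -mulr_natr; apply/dvdp_mulr/dvdp_mull.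
have g0 : g = 0.
  apply: IHi.
  - by apply/leq_sizeP => j pj; rewrite gE [f`_j](leq_sizeP _ _ fp) ?mulr0.
  - rewrite /g -mul_polyC dvdp_sub ?dvdp_mull //.
    by apply: (dvdp_trans _ rf); rewrite dvdp_exp2l.
  rewrite -ltnS; apply: leq_trans cf; apply: proper_card; apply/properP; split.
    by apply/subsetP => j; rewrite !inE gE; apply: contraNN => /eqP ->; rewrite mulr0.
  by exists m; rewrite !inE ?fm // gE subrr mul0r eqxx.
(* The integers below [p] stay distinct in [F], so [g = 0] leaves [f] only its term of degree [m].
   Such a monomial does not vanish at 1, although X - 1 divides [f]. *)
have fj (j : 'I_p) : j != m -> f`_j = 0.
  move=> jm; have /eqP := gE j; rewrite g0 coef0 eq_sym mulf_eq0 subr_eq0.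
  case/orP => /eqP // /(natf_inj_pchar pF (ltn_ord j) mp) e.
  by case/eqP: jm; apply: val_inj.
have : f.[1] = 0.
  apply/eqP; rewrite -[_ == 0]/(root f 1) -dvdp_XsubCl.
  by apply: (dvdp_trans _ rf); rewrite exprS dvdp_mulr.
rewrite (horner_coef_wide _ fp) (bigD1 m) //= big1 => [|j /fj ->]; last by rewrite mul0r.
by rewrite expr1n mulr1 addr0 => /eqP; rewrite (negPf fm).
Qed.

(** [mk_monic] keeps X^p - 1, which is monic and nonconstant; Frobenius then makes it a [p]-th
    power. *)
Lemma mk_monic_Xp_sub1 : p \in [pchar F] ->
  mk_monic ('X^p - 1 : {poly F}) = ('X - 1) ^+ p.
Proof.
move=> pF; have p0 := prime_gt0 (pcharf_prime pF).
rewrite /mk_monic size_XnsubC // monicXnsubC // ltnS p0 /=.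
have pP : [pchar {poly F}].-nat p.
  by rewrite pnatE ?(pcharf_prime pF) // pchar_poly.
by rewrite exprDn_pchar // exprNn_pchar // expr1n.
Qed.

(** Since (X - 1)^i divides the modulus (X - 1)^p, reduction preserves divisibility by it.
    Conversely, a multiple of (X - 1)^i of degree below [p] is its own remainder. *)
Lemma repeated_root_codeP i (c : 'rV[F]_p) : p \in [pchar F] -> (i <= p)%N ->
  (c \in repeated_root_code F p i) = (('X - 1) ^+ i %| rVpoly c).
Proof.
move=> pF ip; pose h := ('X^p - 1 : {poly F}).
have hE : mk_monic h = ('X - 1) ^+ p := mk_monic_Xp_sub1 pF.
have size_h : size (mk_monic h) = p.+1.
  by rewrite hE size_exp_XsubC.
have gE : ('qX - 1 : cyc_ring F p) ^+ i = in_qpoly h (('X - 1) ^+ i).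
  by rewrite rmorphXn rmorphB rmorph1.
apply/mem_ideal_code/idP => [[a ->]|/dvdpP[q cE]].
  have -> : coef_row (a * ('qX - 1) ^+ i) =
            poly_rV (Pdiv.CommonRing.rmodp ((a : {poly F}) * ('X - 1) ^+ i) (mk_monic h)).
    have aE : a = in_qpoly h a.
      by apply: val_inj; rewrite /= Pdiv.CommonRing.rmodp_small ?size_mk_monic.
    by rewrite gE [in LHS]aE -rmorphM; apply/rowP => j; rewrite !mxE.
  rewrite poly_rV_K; last first.
    by rewrite -ltnS -size_h Pdiv.CommonRing.ltn_rmodpN0 // mk_monic_neq0.
  have := Pdiv.RingMonic.rdivp_eq (monic_mk_monic h) ((a : {poly F}) * ('X - 1) ^+ i).
  set q := Pdiv.CommonRing.rdivp _ _ => eq_q.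
  rewrite -(@dvdp_addr _ (q * mk_monic h)); last first.
    by rewrite hE dvdp_mull // dvdp_exp2l.
  by rewrite -eq_q dvdp_mull.
exists (in_qpoly h q); rewrite gE -rmorphM -cE; apply/rowP => j; rewrite !mxE.
rewrite in_qpoly_small ?size_h ?ltnS ?size_poly //.
by rewrite coef_rVpoly_ord.
Qed.

(** Row [a] comes from a polynomial of degree [i + a < p]: no coefficient is cut off, and the rows
    form a staircase. *)
Definition repeated_root_mx i : 'M[F]_(p - i, p) :=
  \matrix_(a, x) ('X^a * ('X - 1) ^+ i)`_x.

Lemma mul_repeated_root_mx i (u : 'rV[F]_(p - i)) : (i <= p)%N ->
  rVpoly (u *m repeated_root_mx i) = rVpoly u * ('X - 1) ^+ i.
Proof.
move=> ip; rewrite -[RHS](@poly_rV_K _ p).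
  congr rVpoly; apply/rowP => x; rewrite !mxE [rVpoly u]poly_def mulr_suml coef_sum.
  apply: eq_bigr => a _; rewrite -scalerAl coefZ mxE; congr (_ * _).
  by case: insubP => [b _ /val_inj->//|]; rewrite ltn_ord.
have [->|u0] := eqVneq (rVpoly u) 0; first by rewrite mul0r size_poly0.
rewrite size_mul ?expf_neq0 ?polyXsubC_eq0 // size_exp_XsubC addnS /=.
have su : (size (rVpoly u) <= p - i)%N := size_poly _ _.
by move: su; rewrite leq_subRL // addnC.
Qed.

Lemma row_free_repeated_root_mx i : (i <= p)%N -> row_free (repeated_root_mx i).
Proof.
move=> ip; apply: inj_row_free => u u0.
have /esym/eqP := mul_repeated_root_mx u ip; rewrite u0 linear0.
rewrite mulf_eq0 expf_eq0 polyXsubC_eq0 andbF orbF => /eqP u0'.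
by rewrite -(rVpolyK u) u0' linear0.
Qed.

Lemma repeated_root_mx_stair i (a : 'I_(p - i)) (x : 'I_p) :
  (i + a < x)%N -> repeated_root_mx i a x = 0.
Proof.
move=> ax; rewrite mxE nth_default // size_mul ?expf_neq0 ?polyX_eq0 ?polyXsubC_eq0 //.
by rewrite size_polyXn size_exp_XsubC addnS addSn addnC.
Qed.

Lemma mul_repeated_root_mx_code i (u : 'rV[F]_(p - i)) : p \in [pchar F] -> (i <= p)%N ->
  u *m repeated_root_mx i \in repeated_root_code F p i.
Proof.
by move=> pF ip; rewrite repeated_root_codeP // mul_repeated_root_mx // dvdp_mull.
Qed.

(** The Singleton bound gives dimension at most [p - i]; the row-free matrix [repeated_root_mx]
    supplies a subspace of exactly that dimension. *)
Lemma repeated_root_code_mds i : p \in [pchar F] -> (i <= p)%N ->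
  mds (repeated_root_code F p i) i.
Proof.
move=> pF ip; have wt : weight_gt (repeated_root_code F p i) i.
  move=> c; rewrite repeated_root_codeP // => rc cc.
  rewrite -(rVpolyK c); suff -> : rVpoly c = 0 by rewrite linear0.
  apply: (repeated_root_weight pF (size_poly _ _) rc).
  (* Supports of row vectors are sets of pairs with first component in ['I_1], so exponents are
     paired with 0. *)
  apply: leq_trans cc; rewrite -(card_imset _ (_ : injective (pair (0 : 'I_1)))); last first.
    by move=> j k [].
  apply/subset_leq_card/subsetP => _ /imsetP[j + ->].
  by rewrite !inE coef_rVpoly_ord.
split=> //; apply/eqP; rewrite eqn_leq dimv_leq_weight_gt //=.
pose f := linfun (mulmxr (repeated_root_mx i)) : 'Hom('rV[F]_(p - i), 'rV[F]_p).
have f_inj : lker f == 0%VS.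
  by apply/lker0P => u v; rewrite !lfunE; apply/row_free_inj/row_free_repeated_root_mx.
have -> : (p - i = \dim (f @: fullv))%N.
  by rewrite limg_dim_eq ?(eqP f_inj) ?capv0 // dimvf dim_matrix mul1r.
apply: dimvS; apply/subvP => _ /memv_imgP[u _ ->].
by rewrite lfunE mul_repeated_root_mx_code.
Qed.

End RepeatedRoot.

Theorem lemma4p5 (p : nat) (F : finFieldType) (i1 i2 r alpha : nat) :
  prime p ->
  p \in [pchar F]%R ->
  i1 < p -> i2 < p ->
  let C1 := repeated_root_code F p i1 in
  let C2 := repeated_root_code F p i2 in
  let k1 := p - i1 in
  let k2 := p - i2 in
  1 <= r <= k1 * k2 ->
  alpha * k1 < r <= (alpha + 1) * k1 ->
  [/\ \dim C1 = k1,
      \dim C2 = k2,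
      ghw (product_code C1 C2) r = dstar C1 C2 r
    & dstar C1 C2 r =
        min_over (mem (two_value_partitions alpha k1 k2 r))
                 (@nabla F p p C1 C2 k1 k2)].
Proof.
move=> _ pF i1p i2p C1 C2 k1 k2 /andP[r_gt0 rk] /andP[ar ra].
have C1d : mds C1 i1 := repeated_root_code_mds pF (ltnW i1p).
have C2d : mds C2 i2 := repeated_root_code_mds pF (ltnW i2p).
have dstarE : dstar C1 C2 r = min_over (mem (partitions k1 k2 r)) (@nabla F p p C1 C2 k1 k2).
  by rewrite /dstar C1d.2 C2d.2.
have upper t : t \in partitions k1 k2 r -> exists D : {vspace 'M[F]_p},
    [/\ (D <= product_code C1 C2)%VS, \dim D = r & #|suppv D| <= nabla C1 C2 t].
  apply: (exists_subcode_leq_nabla C1d C2d (ltnW i1p)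
            (row_free_repeated_root_mx F (ltnW i1p))
            (row_free_repeated_root_mx F (ltnW i2p))).
  - by move=> u; apply: mul_repeated_root_mx_code pF (ltnW i1p).
  - by move=> u; apply: mul_repeated_root_mx_code pF (ltnW i2p).
  - exact: repeated_root_mx_stair.
  - exact: repeated_root_mx_stair.
have k1_gt0 : 0 < k1 by rewrite subn_gt0.
(* The largest admissible [beta] shows that both families of partitions are nonempty, so no minimum
   over them is the default 0. *)
have [||t0 t0S _] := @exists_two_value_partition alpha k1 k2 r (minn k2 r) k1_gt0.
- by case: (leqP k2 r) => _; rewrite ?leq_pmulr // mulnC.
- rewrite leqnn andbT leq_min -(ltn_pmul2r k1_gt0) (mulnC k2) (leq_trans ar rk).
  by rewrite (leq_ltn_trans _ ar) // leq_pmulr.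
have twoP t : t \in two_value_partitions alpha k1 k2 r -> t \in partitions k1 k2 r.
  by rewrite inE => /andP[].
have [D0 [D0C dD0 _]] := upper _ (twoP _ t0S).
(* The subcode built from [t0] shows that the product code has dimension at least [r], so its [r]-th
   weight is attained. *)
have [|D [DC dD ghwE]] := @ghwP _ _ _ (product_code C1 C2) r.
  by rewrite -dD0 dimvS.
(* The three inequalities that follow form a cycle through the minimum over the two-value family,
   the weight and [dstar], forcing equality. *)
have min_ghw : min_over (mem (two_value_partitions alpha k1 k2 r)) (@nabla F p p C1 C2 k1 k2)
    <= ghw (product_code C1 C2) r.
  have := @nabla_two_value_leq _ _ _ C1 C2 i1 i2 alpha D C1d C2d i1p DC.
  rewrite dD ghwE => /(_ ar)[t tS].
  by apply: leq_trans; apply: min_over_leq.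
have ghw_dstar : ghw (product_code C1 C2) r <= dstar C1 C2 r.
  rewrite dstarE.
  have [|t [tP -> _]] := @min_overP _ (mem (partitions k1 k2 r)) (@nabla F p p C1 C2 k1 k2).
    by exists t0; apply: twoP.
  have [E [EC <- nablaE]] := upper t tP; exact: leq_trans (ghw_leq EC (subxx _)) nablaE.
have dstar_min : dstar C1 C2 r <= min_over (mem (two_value_partitions alpha k1 k2 r))
    (@nabla F p p C1 C2 k1 k2).
  rewrite dstarE.
  have [|t [tS -> _]] := @min_overP _ (mem (two_value_partitions alpha k1 k2 r))
    (@nabla F p p C1 C2 k1 k2).
    by exists t0; apply: t0S.
  move: (twoP t tS); exact: min_over_leq.
split; [exact: C1d.2 | exact: C2d.2 | |]; apply/eqP; rewrite eqn_leq.
  by rewrite ghw_dstar (leq_trans dstar_min).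
by rewrite dstar_min (leq_trans min_ghw).
Qed.
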